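(* Assume that the repository has $n$ packages and no known dependencies ($K=\emptyset$), and contains at most $d$ defects, at most $u$ unknown dependencies, and at most $c$ unknown weak conflicts. For the case that $c\le 2u$, any non-adaptive algorithm that solves Maximal Sub-repository must use at least $\mathcal S_{n,\,d+\lceil c/2\rceil-1,\,u+1}$ queries.
   Context: A repository consists of a finite set $P$ of $n$ packages, a set $K\subseteq P\times P$ of known dependencies, a set $U\subseteq P\times P$ of unknown dependencies, a set $C$ of unknown conflicts (unordered pairs of distinct packages), and a set $D\subseteq P$ of defects. A pair $(q,p)\in K\cup U$ means that $q$ depends on $p$: any installation including $q$ but not $p$ fails. An installation is a subset $I\subseteq P$; it is successful iff it contains no defect, contains $p$ whenever it contains $q$ with $(q,p)\in K\cup U$, and contains no two packages $p,q$ with $\{p,q\}\in C$. Defects are the packages that cannot be part of any successful installation; thus a package that depends on a defect is itself a defect, i.e. $((P\setminus D)\times D)\cap(K\cup U)=\emptyset$. Given two packages $p,q\in P$, $p$ weakly conflicts with $q$ if no successful installation includes both $p$ and $q$. An algorithm is given $P$, $K$ and the bounds $d,u,c$. A query is an installation $I\subseteq P$; an oracle answers whether it is successful. A non-adaptive algorithm computes its whole set of queries from its input and then computes its output from the answers. The cost is the number of queries. Maximal Sub-repository: find a maximum-size set of packages $P_{max}\subseteq P$ that can be successfully installed. An $(n,a,b)$-cover-free family (CFF) is a set $\mathcal F\subseteq\{0,1\}^n$ such that for all disjoint $S_1,S_2\subseteq\{1,\dots,n\}$ with $|S_1|=a$, $|S_2|=b$ there is $v\in\mathcal F$ whose entries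 are all $0$ on $S_1$ and all $1$ on $S_2$. $\mathcal S_{n,a,b}$ denotes the minimal size of an $(n,a,b)$-CFF.
   Formalization: Weak conflicts are counted only between distinct non-defect packages: literally a defect weakly conflicts with every package, and the claim fails (e.g. n≥2, d=1, u=c=0); also d=c=0, where the index would be -1, is excluded. *)

(* Defs.v *)
From mathcomp Require Import all_boot.
Set Implicit Arguments.
Unset Strict Implicit.
Unset Printing Implicit Defensive.

Section Repository.
Variable P : finType.

(* A pair (q, p) in [known] or [unknown] means that q depends on p; a conflict
   is an unordered pair, i.e. a two-element set of packages. *)
Record repository := Repository {
  known : {set P * P};
  unknown : {set P * P};
  conflicts : {set {set P}};
  defects : {set P}
}.

Definition successful (R : repository) (I : {set P}) : bool :=
  [&& [disjoint I & defects R],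
      [forall q in I, forall p,
         ((q, p) \in known R :|: unknown R) ==> (p \in I)]
    & [forall p in I, forall q in I, [set p; q] \notin conflicts R]].

(* The defects are exactly the packages that cannot be installed, including
   those that are uninstallable because of their dependencies and conflicts. *)
Definition well_formed (R : repository) : Prop :=
  (forall e, e \in conflicts R -> #|e| = 2) /\
  (forall p, p \in defects R <->
     ~ exists I : {set P}, successful R I /\ p \in I).

Definition weakly_conflicts (R : repository) (p q : P) : bool :=
  ~~ [exists I : {set P}, [&& successful R I, p \in I & q \in I]].

(* The unordered pairs of distinct weakly conflicting packages. Pairs with a
   defect are left out: a defect weakly conflicts with every package, so that
   counting them would let a bound on the number of weak conflicts rule out
   defects altogether. *)
Definition weak_conflicts (R : repository) : {set {set P}} :=
  [set [set p; q] | p in ~: defects R, q in ~: defects R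
                  & (p != q) && weakly_conflicts R p q].

Definition is_maximal_subrepository (R : repository) (I : {set P}) : Prop :=
  successful R I /\ forall J : {set P}, successful R J -> #|J| <= #|I|.

(* What a non-adaptive algorithm does on a fixed input: the output depends
   only on the oracle's answers to the queries. *)
Record query_plan := QueryPlan {
  queries : {set {set P}};
  output : {ffun {I : {set P} | I \in queries} -> bool} -> {set P}
}.

Definition answers (Q : query_plan) (R : repository) :
    {ffun {I : {set P} | I \in queries Q} -> bool} :=
  [ffun I => successful R (val I)].

(* The input consists of the known dependencies and of the bounds d, u, c. *)
Definition nonadaptive_algorithm :=
  {set P * P} -> nat -> nat -> nat -> query_plan.

Definition cost (A : nonadaptive_algorithm) (K : {set P * P}) (d u c : nat) :
    nat :=
  #|queries (A K d u c)|.

Definition solves_maximal_subrepository (A : nonadaptive_algorithm)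
    (K : {set P * P}) (d u c : nat) : Prop :=
  forall R : repository, well_formed R -> known R = K ->
    #|defects R| <= d -> #|unknown R| <= u -> #|weak_conflicts R| <= c ->
    is_maximal_subrepository R (output (answers (A K d u c) R)).

End Repository.

Definition is_cff (n a b : nat) (F : {set {ffun 'I_n -> bool}}) : bool :=
  [forall S1 : {set 'I_n}, forall S2 : {set 'I_n},
    [&& [disjoint S1 & S2], #|S1| == a & #|S2| == b] ==>
    [exists v in F, [forall i in S1, ~~ v i] && [forall i in S2, v i]]].

Lemma is_cff_setT n a b : @is_cff n a b setT.
Proof.
apply/forallP => S1; apply/forallP => S2; apply/implyP => /and3P [dis _ _].
apply/existsP; exists [ffun i => i \in S2]; rewrite inE /=.
apply/andP; split; apply/forallP => i; apply/implyP => iS; rewrite ffunE //.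
by rewrite (disjointFr dis iS).
Qed.

Lemma cff_size_ex n a b :
  exists m, [exists F, @is_cff n a b F && (#|F| == m)].
Proof.
by exists #|[set: {ffun 'I_n -> bool}]|; apply/existsP; exists setT;
  rewrite is_cff_setT eqxx.
Qed.

Definition min_cff_size (n a b : nat) : nat := ex_minn (cff_size_ex n a b).

(* Main.v *)
(** If the queries are not a cover-free family, some disjoint [S1], [S2] of
    sizes [d + uphalf c - 1] and [u + 1] are such that no query avoids [S1] and
    contains [S2]. Two repositories that differ only on such installations, but
    have no common maximal sub-repository, then give a contradiction. In both,
    a package [s] of [S2] depends on other packages of [S2].

    If [c = 0], [S1] consists of defects, [s] depends on the rest of [S2], and
    [s] is a defect in the second repository only.

    If [c > 0], write [S1 = D :|: T] with [D] the defects and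
    [#|T| = uphalf c - 1], and [S2 = {s, s'} :|: B], where [s] depends on [B].
    Each [t] in [T] conflicts with [s] and with a private package [f t] of [B],
    so that [~: S1] is the only maximal sub-repository: keeping [k > 0] packages
    of [T] forces the removal of [k + 1] packages of [S2]. The second repository
    has the additional conflict [{s, s'}]. *)
Require Import Defs.
From mathcomp Require Import all_boot.
Set Implicit Arguments.
Unset Strict Implicit.
Unset Printing Implicit Defensive.

(** * Subsets and injections of prescribed size *)

Lemma exists_subset_card (T : finType) (A : {set T}) (m : nat) :
  m <= #|A| -> exists2 B : {set T}, B \subset A & #|B| = m.
Proof.
case/card_geqP => s [s_uniq s_size sA]; exists [set x in s].
  by apply/subsetP => x; rewrite inE; exact: sA.
by rewrite cardsE -s_size; apply/card_uniqP.
Qed.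

Lemma exists_injection (T : finType) (A B : {set T}) :
  #|A| <= #|B| ->
  exists2 f : T -> T, {in A &, injective f} & {in A, forall x, f x \in B}.
Proof.
move=> leAB; have [-> | [x0 _]] := set_0Vmem A.
  by exists id => x; rewrite inE.
have ltB x : x \in A -> index x (enum A) < size (enum B).
  by move=> xA; rewrite -cardE (leq_trans _ leAB) // cardE index_mem mem_enum.
(* Elements are matched by their positions in the two enumerations; [x0] is only a default value. *)
exists (fun x => nth x0 (enum B) (index x (enum A))) => [x y xA yA | x xA].
  move/eqP; rewrite nth_uniq ?enum_uniq ?ltB // => /eqP.
  by apply: (index_inj x0); rewrite mem_enum.
by rewrite -mem_enum mem_nth ?ltB.
Qed.

(** * Hub repositories: successful installations and weak conflicts *)

Section HubRepository.
Variable P : finType.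
Implicit Types (D B T V I O : {set P}) (s : P) (f : P -> P).

(** [V] holds packages that conflict with [s] but have no partner in [B]; for [c > 0] it is what
    distinguishes the two repositories. *)
Definition hub_conflicts s f T V : {set {set P}} :=
  [set [set t; s] | t in T :|: V] :|: [set [set t; f t] | t in T].

Definition hub_repository D s B f T V : repository P :=
  Repository set0 [set (s, b) | b in B] (hub_conflicts s f T V) D.

Variables (s : P) (B : {set P}) (f : P -> P) (T V : {set P}).
Hypothesis TV_hub : [disjoint T :|: V & s |: B].
Hypothesis f_B : {in T, forall t, f t \in B}.

Lemma hub_conflict_card e : e \in hub_conflicts s f T V -> #|e| = 2.
Proof.
case/setUP => /imsetP [t tT ->]; rewrite cards2.
  by have := disjointFr TV_hub tT; rewrite in_setU1 eq_sym; case: eqP.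
have tTV : t \in T :|: V by rewrite inE tT.
have [ft | //] := eqVneq t (f t).
by have := disjointFr TV_hub tTV; rewrite in_setU1 {2}ft f_B ?orbT.
Qed.

Lemma hub_successfulP D I :
  reflect [/\ [disjoint I & D], s \in I -> B \subset I
            & {in hub_conflicts s f T V, forall e : {set P}, ~~ (e \subset I)}]
          (successful (hub_repository D s B f T V) I).
Proof.
apply: (iffP and3P) => [] [disD deps confl]; split=> //=.
- move=> sI; apply/subsetP => b bB; move/'forall_implyP: deps => /(_ s sI).
  by move/'forall_implyP/(_ b); apply; rewrite set0U imset_f.
- move=> e eE; apply/negP => eI.
  have /eqP /cards2P [p [q [_ e_pq]]] := hub_conflict_card eE.
  move: eI; rewrite e_pq subUset !sub1set => /andP [pI qI].
  move/'forall_implyP: confl => /(_ p pI) /'forall_implyP /(_ q qI).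
  by rewrite -e_pq eE.
- apply/'forall_implyP => q qI; apply/'forall_implyP => p; rewrite set0U.
  by case/imsetP => b bB [qs ->]; apply: (subsetP (deps _)) => //; rewrite -qs.
- apply/'forall_implyP => p pI; apply/'forall_implyP => q qI; apply/negP => eE.
  by have := confl _ eE; rewrite subUset !sub1set pI qI.
Qed.

(** Every conflict has an end in [T :|: V], hence outside [s |: B], so this end can only be [q]. *)
Lemma hub_conflict_closed e q :
  e \in hub_conflicts s f T V -> e \subset q |: (s |: B) ->
  [set s; q] \in hub_conflicts s f T V.
Proof.
move=> eE; have [t tTV te] : exists2 t, t \in T :|: V & t \in e.
  case/setUP: eE => /imsetP [t tT ->]; exists t => //; rewrite ?set21 //.
  by rewrite inE tT.
move/subsetP/(_ t te); rewrite inE (disjointFr TV_hub tTV) orbF inE => /eqP <-.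
by apply/setUP; left; apply/imsetP; exists t; rewrite // setUC.
Qed.

(** Only [s] has dependencies, so the pair itself is an installation unless it contains [s]; in that
    case adding [B] repairs it and creates no conflict. *)
Lemma hub_pair_successful D p q :
  [disjoint B & D] -> p \notin D -> q \notin D ->
  [set p; q] \notin hub_conflicts s f T V ->
  exists I, [/\ successful (hub_repository D s B f T V) I, p \in I & q \in I].
Proof.
move=> disB; wlog p_hub : p q / (s \in [set p; q]) ==> (p == s) => [hwlog|].
  move=> pD qD pq; have [ps|ps] := eqVneq p s.
    by apply: hwlog => //; rewrite ps eqxx implybT.
  have [|||| I [? ? ?]] := hwlog q p => //; last by exists I.
    by rewrite !inE [s == p]eq_sym (negPf ps) orbF eq_sym implybb.
  by rewrite setUC.
move=> pD qD pq; have [ps|ps] := eqVneq p s.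
  exists (q |: (s |: B)); rewrite !inE ps !eqxx !orbT; split=> //.
  apply/hub_successfulP; split.
  - rewrite disjoint_subset; apply/subsetP => x; rewrite !inE.
    case/or3P => [/eqP ->|/eqP ->|xB] //; first by rewrite -ps.
    by rewrite (disjointFr disB xB).
  - by move=> _; apply/subsetP => x xB; rewrite !inE xB !orbT.
  - move=> e eE; apply: contra pq => /(hub_conflict_closed eE).
    by rewrite ps.
exists [set p; q]; rewrite set21 set22; split=> //.
apply/hub_successfulP; split.
- rewrite disjoint_subset; apply/subsetP => x.
  by rewrite !inE => /orP [] /eqP ->.
- by move=> spq; rewrite spq (negPf ps) in p_hub.
- move=> e eE; apply: contra pq => e_pq; suff /eqP <- : e == [set p; q] by [].
  by rewrite eqEcard e_pq (hub_conflict_card eE) cards2; case: (p != q).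
Qed.

Lemma hub_well_formed D :
  [disjoint B & D] -> well_formed (hub_repository D s B f T V).
Proof.
move=> disB; split=> [|p]; first exact: hub_conflict_card.
split=> [pD [I [/hub_successfulP [disI _ _] pI]] | not_inst].
  by rewrite (disjointFr disI pI) in pD.
apply/negPn/negP => pD; apply: not_inst.
(* A single package is the pair [[set p; p]], which has one element and so is no conflict. *)
have [|I [? ? _]] := hub_pair_successful disB pD pD; last by exists I.
by apply/negP => /hub_conflict_card; rewrite cards2 eqxx.
Qed.

Lemma hub_weak_conflicts D :
  [disjoint B & D] ->
  #|weak_conflicts (hub_repository D s B f T V)| <= #|T :|: V| + #|T|.
Proof.
move=> disB; apply: (@leq_trans #|hub_conflicts s f T V|); last first.
  by rewrite (leq_trans (leq_card_setU _ _)) // leq_add // leq_imset_card.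
apply: subset_leq_card; apply/subsetP => _ /imset2P [p q + + ->].
rewrite !inE => pD /and3P [qD _ /existsP wconfl]; apply/negPn/negP => pq.
rewrite -/(hub_conflicts s f T V) in pq.
have [|I [sI pI qI]] := hub_pair_successful disB pD qD; first by rewrite !inE.
by apply: wconfl; exists I; rewrite sI pI.
Qed.

Lemma hub_unknown_card D : #|unknown (hub_repository D s B f T V)| <= #|B|.
Proof. exact: leq_imset_card. Qed.

End HubRepository.

(** * Maximal sub-repositories of a hub repository *)

Lemma hub_maximal_mem (P : finType) (s s' : P) (B : {set P}) (f : P -> P)
    (T D O : {set P}) :
  [disjoint T & s |: B] -> {in T, forall t, f t \in B} ->
  {in T &, injective f} -> s \notin B -> [disjoint s |: B & D] ->
  s' \notin D :|: T ->
  is_maximal_subrepository (hub_repository D s B f T set0) O ->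
  s \in O /\ s' \in O.
Proof.
move=> T_hub f_B f_inj sB hub_D s'W [+ maxO].
have TV_hub : [disjoint T :|: set0 & s |: B] by rewrite setU0.
have hubW x : x \in s |: B -> x \notin D :|: T.
  by move=> xsB; rewrite inE (disjointFr hub_D xsB) (disjointFl T_hub xsB).
move=> /(hub_successfulP TV_hub f_B) [O_D sO_B O_confl].
(* The competitor [~: (D :|: T)] is successful because every conflict meets [T]. *)
have O_W : #|~: (D :|: T)| <= #|O|.
  apply: maxO; apply/(hub_successfulP TV_hub f_B); split.
  - by rewrite disjoints_subset setCS subsetUl.
  - by move=> _; apply/subsetP => b bB; rewrite inE hubW // inE bB orbT.
  - move=> e /setUP [] /imsetP [t tT ->]; rewrite ?setU0 in tT.
      by rewrite subUset !sub1set !inE tT orbT.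
    by rewrite subUset !sub1set !inE tT orbT.
apply/andP; rewrite -[_ && _]negbK negb_and; apply/negP => missing.
(* Outside [T], [O] lies in the competitor, so it is smaller as soon as it keeps fewer packages of
   [T] than it loses from the competitor. *)
suff lt_kept : #|O :&: T| < #|~: (D :|: T) :\: O|.
  move: O_W; rewrite leqNgt => /negP; apply.
  rewrite -(cardsID T O) -(cardsID O (~: (D :|: T))) addnC.
  rewrite -addnS leq_add // subset_leq_card //; apply/subsetP => x.
  by rewrite !inE => /andP [/negPf -> xO]; rewrite (disjointFr O_D xO) xO.
(* If [s] is kept, nothing of [T] is, while [s'] is lost. Otherwise [s] and the distinct partners of
   all kept packages of [T] are lost. *)
have [sO | sO] := boolP (s \in O).
  rewrite sO /= in missing.
  suff -> : O :&: T = set0.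
    rewrite cards0 card_gt0; apply/set0Pn; exists s'.
    by rewrite in_setD in_setC missing.
  apply/setP => t; rewrite !inE; apply/negP => /andP [tO tT].
  have /O_confl : [set t; s] \in hub_conflicts s f T set0.
    by apply/setUP; left; apply: (imset_f (fun t => [set t; s])); rewrite setU0.
  by rewrite subUset !sub1set tO sO.
have f_injO : {in O :&: T &, injective f}.
  by move=> x y /setIP [_ xT] /setIP [_ yT]; apply: f_inj.
have sfO : s \notin f @: (O :&: T).
  apply: contra sB => /imsetP [t /setIP [_ tT] ->]; exact: f_B.
have <- : #|s |: f @: (O :&: T)| = #|O :&: T|.+1.
  by rewrite cardsU1 sfO card_in_imset.
rewrite subset_leq_card // subUset sub1set in_setD sO in_setC hubW ?setU11 //=.
apply/subsetP => _ /imsetP [t /setIP [tO tT] ->].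
rewrite in_setD in_setC hubW ?andbT; last by rewrite inE f_B ?orbT.
apply/negP => ftO.
have /O_confl : [set t; f t] \in hub_conflicts s f T set0.
  by apply/setUP; right; apply/imsetP; exists t.
by rewrite subUset !sub1set tO ftO.
Qed.

(** * Indistinguishable repositories and the separation of [S1] from [S2] *)

Section LowerBound.
Variables (P : finType) (d u c : nat) (A : nonadaptive_algorithm P).
Hypothesis solvesA : solves_maximal_subrepository A set0 d u c.

Lemma hub_output (s : P) (B : {set P}) (f : P -> P) (T V D : {set P}) :
  [disjoint T :|: V & s |: B] -> {in T, forall t, f t \in B} ->
  [disjoint B & D] ->
  #|D| <= d -> #|B| <= u -> #|T :|: V| + #|T| <= c ->
  let R := hub_repository D s B f T V in
  is_maximal_subrepository R (output (answers (A set0 d u c) R)).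
Proof.
move=> TV_hub f_B disB Dd Bu TVc; apply: solvesA => //.
- exact: hub_well_formed.
- exact: leq_trans (hub_unknown_card _ _ _ _ _ _) Bu.
- exact: leq_trans (hub_weak_conflicts TV_hub f_B disB) TVc.
Qed.

Lemma queries_separate (S1 S2 : {set P}) :
  c <= 2 * u -> 0 < d + uphalf c -> [disjoint S1 & S2] ->
  #|S1| = d + uphalf c - 1 -> #|S2| = u + 1 ->
  exists2 I, I \in queries (A set0 d u c) & [disjoint S1 & I] && (S2 \subset I).
Proof.
move=> c2u dc_gt0 dis12 card1 card2.
apply/exists_inP; apply: contraT => /exists_inPn no_query.
(* It suffices that [R2] accepts fewer installations than [R1], and that those it loses have the
   shape that no query has. *)
have answers_eq R1 R2 :
    (forall I, successful R2 I -> successful R1 I) ->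
    (forall I, successful R1 I -> ~~ successful R2 I ->
       [disjoint S1 & I] && (S2 \subset I)) ->
    answers (A set0 d u c) R1 = answers (A set0 d u c) R2.
  move=> R21 R12; apply/ffunP => -[I Iq]; rewrite !ffunE /=.
  apply/idP/idP => [R1I|]; last exact: R21.
  by apply: contraT => /(R12 _ R1I); rewrite (negPf (no_query I Iq)).
have /card_gt0P [s sS2] : 0 < #|S2| by rewrite card2 addn1.
have cardS2s : #|S2 :\ s| = u.
  by move: card2; rewrite (cardsD1 s) sS2 add1n addn1 => -[].
have sS1 : s \notin S1 by rewrite (disjointFl dis12 sS2).
have [c0 | c_gt0] := posnP c.
  rewrite c0 addn0 in dc_gt0; rewrite c0 addn0 in card1.
  have TV_hub : [disjoint (set0 : {set P}) :|: set0 & s |: S2 :\ s].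
    by rewrite setU0 disjoints_subset sub0set.
  have id_B : {in set0, forall t : P, id t \in S2 :\ s}.
    by move=> t; rewrite inE.
  have hub_D : [disjoint s |: S2 :\ s & S1] by rewrite setD1K // disjoint_sym.
  have cardTV : #|(set0 : {set P}) :|: set0| + #|(set0 : {set P})| <= c.
    by rewrite setU0 cards0.
  pose R1 := hub_repository S1 s (S2 :\ s) id set0 set0.
  pose R2 := hub_repository (s |: S1) s (S2 :\ s) id set0 set0.
  have max1 : is_maximal_subrepository R1 (output (answers (A set0 d u c) R1)).
    apply: hub_output; rewrite ?cardS2s ?card1 ?leq_subr //.
    exact: disjointWl (subsetUr _ _) hub_D.
  have max2 : is_maximal_subrepository R2 (output (answers (A set0 d u c) R2)).
    apply: hub_output; rewrite ?cardS2s ?cardsU1 ?sS1 ?card1 ?subnKC //.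
    rewrite disjoint_sym disjoints_subset; apply/subsetP => x.
    by rewrite !inE; case: eqP => //= _ xS1; rewrite (disjointFr dis12 xS1).
  have answers12 : answers (A set0 d u c) R1 = answers (A set0 d u c) R2.
    apply: answers_eq => I.
      move=> /(hub_successfulP TV_hub id_B) [I_D sI_B confl].
      apply/(hub_successfulP TV_hub id_B); split=> //.
      exact: disjointWr (subsetUr _ _) I_D.
    move=> /(hub_successfulP TV_hub id_B) [I_D sI_B confl] R2I.
    have sI : s \in I.
      apply: contraR R2I => sI.
      apply/(hub_successfulP TV_hub id_B); split=> //.
      by rewrite disjoint_sym disjoints_subset subUset sub1set inE sI
        -disjoints_subset disjoint_sym.
    by rewrite disjoint_sym I_D -(setD1K sS2) subUset sub1set sI sI_B.
  (* With [T] empty, [s] itself can serve as [s']; only its membership in the output is wanted. *)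
  have [|||| s_out _] := hub_maximal_mem (s' := s) _ id_B _ _ hub_D _ max1.
  - by rewrite disjoints_subset sub0set.
  - by move=> x y; rewrite inE.
  - by rewrite setD11.
  - by rewrite setU0.
  case: max2 => /(hub_successfulP TV_hub id_B) [O_D _ _] _.
  by rewrite answers12 (disjointFl O_D) ?setU11 in s_out.
have uc_gt0 : 0 < uphalf c by rewrite uphalf_gt0.
(* This is the number of weak conflicts allowed for in [R2]: [uphalf c] with [s], and one fewer with
   partners. *)
have c_eq : uphalf c + (uphalf c).-1 <= c.
  rewrite -subn1 addnBA // leq_subLR addnn uphalf_half doubleD.
  by rewrite -[X in _ <= 1 + X]odd_double_half addnA leq_add2r; case: (odd c).
(* The hypothesis [c <= 2 * u] makes the [u.-1] packages of [B] enough to give each element of [T] a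
   private partner. *)
have uc_u : uphalf c <= u.
  by rewrite leq_uphalf_double -mul2n.
have /card_gt0P [s' s'S2] : 0 < #|S2 :\ s|.
  by rewrite cardS2s (leq_trans uc_gt0).
have s'S1 : s' \notin S1.
  by case/setD1P: s'S2 => _ /(disjointFl dis12) ->.
have s'_neq_s : s' != s by case/setD1P: s'S2.
pose B := S2 :\ s :\ s'.
have cardB : #|B| = u.-1.
  by move: cardS2s; rewrite (cardsD1 s') s'S2 add1n => <-.
have [D DS1 cardD] : exists2 D : {set P}, D \subset S1 & #|D| = d.
  by apply: exists_subset_card; rewrite card1 -addnBA // leq_addr.
pose T := S1 :\: D.
have S1E : D :|: T = S1 by rewrite /T setDE setUIr setUCr setIT; apply/setUidPr.
have cardT : #|T| = (uphalf c).-1.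
  by rewrite cardsDS // cardD card1 -addnBA // addKn subn1.
have [f f_inj f_B] : exists2 f : P -> P,
    {in T &, injective f} & {in T, forall t, f t \in B}.
  by apply: exists_injection; rewrite cardT cardB -!subn1 leq_sub2r.
have hubS2 : s |: B \subset S2.
  by rewrite subUset sub1set sS2 !subDset !(subsetU, subxx, orbT).
have S2E : s' |: (s |: B) = S2 by rewrite setUCA setD1K // setD1K.
have S1_hub : [disjoint S1 & s |: B] := disjointWr hubS2 dis12.
have T_hub : [disjoint T & s |: B] := disjointWl (subsetDl _ _) S1_hub.
have hub_D : [disjoint s |: B & D].
  by rewrite disjoint_sym (disjointWl DS1).
have B_D : [disjoint B & D] := disjointWl (subsetUr _ _) hub_D.
have T0_hub : [disjoint T :|: set0 & s |: B] by rewrite setU0.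
have Ts'_hub : [disjoint T :|: [set s'] & s |: B].
  by rewrite disjoints_subset subUset -disjoints_subset T_hub sub1set !inE
    (negPf s'_neq_s) eqxx.
have cardTs' : #|T :|: [set s']| = uphalf c.
  by rewrite setUC cardsU1 cardT inE (negPf s'S1) andbF add1n prednK.
pose R1 := hub_repository D s B f T set0.
pose R2 := hub_repository D s B f T [set s'].
have max1 : is_maximal_subrepository R1 (output (answers (A set0 d u c) R1)).
  apply: hub_output; rewrite ?cardD ?cardB ?leq_pred //.
  rewrite (leq_trans _ c_eq) // setU0 cardT leq_add2r leq_pred //.
have max2 : is_maximal_subrepository R2 (output (answers (A set0 d u c) R2)).
  by apply: hub_output; rewrite ?cardD ?cardB ?leq_pred ?cardTs' ?cardT.
have confl12 : hub_conflicts s f T [set s'] =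
               [set s'; s] |: hub_conflicts s f T set0.
  by rewrite /hub_conflicts setU0 imsetU imset_set1 setUAC setUC.
have answers12 : answers (A set0 d u c) R1 = answers (A set0 d u c) R2.
  apply: answers_eq => I.
    move=> /(hub_successfulP Ts'_hub f_B) [I_D sI_B confl].
    apply/(hub_successfulP T0_hub f_B); split=> // e eE.
    by apply: confl; rewrite confl12 inE eE orbT.
  move=> /(hub_successfulP T0_hub f_B) [I_D sI_B confl] R2I.
  have /andP [s'I sI] : (s' \in I) && (s \in I).
    apply: contraR R2I => ssI.
    apply/(hub_successfulP Ts'_hub f_B); split=> // e.
    rewrite confl12 => /setU1P [-> | /confl //].
    by rewrite subUset !sub1set.
  rewrite -S2E !subUset !sub1set s'I sI sI_B // !andbT.
  rewrite disjoints_subset; apply/subsetP => x xS1; rewrite inE.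
  apply/negP => xI; move: xS1; rewrite -S1E inE (disjointFr I_D xI) /= => xT.
  have /confl : [set x; s] \in hub_conflicts s f T set0.
    by apply/setUP; left; apply: (imset_f (fun t => [set t; s])); rewrite setU0.
  by rewrite subUset !sub1set xI sI.
have [|| sO s'O] := hub_maximal_mem (s' := s') T_hub f_B f_inj _ hub_D _ max1.
- by rewrite !inE eqxx andbF.
- by rewrite S1E.
case: max2 => /(hub_successfulP Ts'_hub f_B) [_ _ confl] _.
have /confl : [set s'; s] \in hub_conflicts s f T [set s'].
  by rewrite confl12 setU11.
by rewrite -answers12 subUset !sub1set sO s'O.
Qed.

End LowerBound.

(** * From queries to a cover-free family *)

Theorem theorem12 (P : finType) (n d u c : nat) (A : nonadaptive_algorithm P) :
  #|P| = n ->
  c <= 2 * u ->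
  0 < d + uphalf c ->
  solves_maximal_subrepository A set0 d u c ->
  min_cff_size n (d + uphalf c - 1) (u + 1) <= cost A set0 d u c.
Proof.
move=> <- c2u dc_gt0 solvesA; rewrite /min_cff_size.
case: ex_minnP => m _ min_m.
(* The characteristic vectors of the queries, with packages numbered by [enum_val]. *)
pose F := [set [ffun i : 'I_#|P| => enum_val i \in (I : {set P})]
          | I in queries (A set0 d u c)].
apply: (@leq_trans #|F|); last exact: leq_imset_card.
apply: min_m; apply/existsP; exists F; rewrite eqxx andbT.
apply/forallP => S1; apply/forallP => S2; apply/implyP.
case/and3P => dis12 /eqP card1 /eqP card2.
have inj := @enum_val_inj P P.
have card_val (S : {set 'I_#|P|}) : #|[set enum_val i | i in S]| = #|S|.
  exact: card_imset.
have [|I Iq /andP [dis sub]] := queries_separate solvesA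
  (S1 := [set enum_val i | i in S1]) (S2 := [set enum_val i | i in S2])
  c2u dc_gt0 _ (etrans (card_val _) card1) (etrans (card_val _) card2).
  rewrite disjoints_subset; apply/subsetP => _ /imsetP [i iS1 ->].
  by rewrite inE mem_imset // (disjointFr dis12 iS1).
apply/exists_inP; exists [ffun i => enum_val i \in I]; first exact: imset_f.
apply/andP; split; apply/forall_inP => i iS; rewrite ffunE.
  by rewrite (disjointFr dis) // imset_f.
by rewrite (subsetP sub) // imset_f.
Qed.
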